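(* There exist positive constants $\delta$, $C$ and $N$ such that for all integers $n\ge N$ and all integers $k$ with $1\le k\le n^{3/4}$, the set of $\alpha\in[0,1]$ (irrational) satisfying \[ S(\alpha,n,k)\ge \left(C\log\lfloor n/k\rfloor\right)^k \] has Lebesgue measure at least $1-\exp(-\delta\log^2 n)$.
   Context: Every irrational $\alpha\in(0,1)$ has a unique continued fraction expansion $\alpha = 1/(a_1(\alpha)+1/(a_2(\alpha)+\cdots))$ with digits $a_i(\alpha)\in\mathbb{N}_{\ge1}$. For $1\le k\le n$ integers, \[ S(\alpha,n,k) := \binom{n}{k}^{-1}\sum_{1\le i_1<\cdots<i_k\le n} a_{i_1}(\alpha)\cdots a_{i_k}(\alpha). \] *)

(* Defs.v *)
From HB Require Import structures.
From mathcomp Require Import all_boot all_order all_algebra.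
From mathcomp Require Import all_classical all_reals all_analysis.
Set Implicit Arguments. Unset Strict Implicit. Unset Printing Implicit Defensive.
Import Order.TTheory GRing.Theory Num.Theory.
Local Open Scope ring_scope.

Definition gauss {R : realType} (x : R) : R := x^-1 - (Num.truncn (x^-1))%:R.

Definition cf_digit {R : realType} (i : nat) (x : R) : nat :=
  Num.truncn ((iter i.-1 gauss x)^-1).

(* S(alpha,n,k) = binom(n,k)^-1 * sum_{i_1<...<i_k <= n} a_{i_1}...a_{i_k} ;
   the k-subsets of {1..n} are indexed as k-subsets A of 'I_n, shifted by one. *)
Definition S {R : realType} (alpha : R) (n k : nat) : R :=
  ('C(n, k)%:R)^-1 *
  \sum_(A : {set 'I_n} | #|A| == k) \prod_(i in A) (cf_digit (i.+1) alpha)%:R.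

(* Main.v *)
Require Import Defs.
From HB Require Import structures.
From mathcomp Require Import all_boot all_order all_algebra.
From mathcomp Require Import all_classical all_reals all_analysis.
From mathcomp Require Import measurable_realfun ring lra.
Import Order.TTheory GRing.Theory Num.Theory.
Import numFieldNormedType.Exports.

(* Put m = n %/ k and cut the first k m digits into k blocks of length m.
   Choosing one index per block gives sum_{|A| = k} prod_{i in A} a_i >=
   prod_blocks (sum of the digits of the block), and 'C(n, k) <= (2 e m)^k, so
   it suffices that every block sum exceeds (m log m) / 8.

   Given its first i digits, the law of G^i alpha (G the Gauss map) has
   distribution function x |-> (1 + t) x / (1 + t x) for some t in [0, 1], hence
   P(a_{i+1} >= j | a_1, ..., a_i) = (1 + t) / (j + t) >= 1 / j.  With
   H_T = 1 + 1/2 + ... + 1/T this yields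
     E[exp(- min(a_{i+1}, T) / T) | a_1, ..., a_i] <= 1 - H_T / (2 T),
   so P(block sum <= s) <= exp(s / T) (1 - H_T / (2 T))^m by Markov's
   inequality.  For T ~ sqrt m and s = (m log m) / 8 this is at most
   exp(- T (log m) / 8), and k of these are absorbed since m >= n^{1/4} - 1. *)

Local Open Scope ring_scope.

(** * Elementary symmetric sums and binomial coefficients *)

Section symmetric_sums.
Context {R : realType}.

(** Expanding the product gives one monomial per choice function [f], picking an index in each
    block. Blocks are disjoint, so distinct choices give distinct k-subsets; the monomials of the
    remaining subsets are nonnegative. *)
Lemma prod_block_sum_le (n k m : nat) (a : nat -> R) :
  (forall i, 0 <= a i) -> (k * m <= n)%N ->
  \prod_(b < k) \sum_(r < m) a (b * m + r)%N <=
  \sum_(A : {set 'I_n} | #|A| == k) \prod_(i in A) a i.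
Proof.
move=> a0 kmn.
have lt_n (b : 'I_k) (r : 'I_m) : (b * m + r < n)%N.
  apply: leq_trans kmn; apply: (@leq_trans (b.+1 * m)).
    by rewrite mulSn addnC ltn_add2r.
  by rewrite leq_mul2r ltn_ord orbT.
pose emb b r := Ordinal (lt_n b r).
have emb_inj b r b' r' : emb b r = emb b' r' -> b = b' /\ r = r'.
  move=> /(congr1 val) /= e.
  have m0 : (0 < m)%N by case: m r {r' b b' e lt_n emb kmn} => // -[].
  have eb : b = b' :> nat.
    by have := congr1 (divn^~ m) e; rewrite !divnMDl// !divn_small// !addn0.
  by split; apply: val_inj => //; move: e; rewrite eb => /addnI.
pose h (f : {ffun 'I_k -> 'I_m}) : {set 'I_n} := [set emb b (f b) | b in 'I_k].
have emb_f_inj (f : {ffun 'I_k -> 'I_m}) : injective (fun b => emb b (f b)).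
  by move=> b b' /emb_inj[].
have h_inj : injective h.
  move=> f g fg; apply/ffunP => b.
  have : emb b (f b) \in h g by rewrite -fg; apply/imsetP; exists b.
  by case/imsetP => b' _ /emb_inj[-> ->].
rewrite bigA_distr_bigA /=.
rewrite (eq_bigr (fun f => \prod_(i in h f) a i)); last first.
  by move=> f _; rewrite big_imset//= => b b' _ _; exact: emb_f_inj.
rewrite -(big_imset (fun A : {set 'I_n} => \prod_(i in A) a i)) /=; last first.
  by move=> f g _ _; exact: h_inj.
rewrite big_mkcond [leRHS]big_mkcond; apply: ler_sum => A _ /=.
have P0 : 0 <= \prod_(i in A) a i by exact: prodr_ge0.
case: ifP => [/imsetP[f _ ->]|_]; last by case: ifP.
by rewrite card_imset ?card_ord ?eqxx.
Qed.

(** With x = 1 / (2 m), a single term of the binomial expansion gives C(n, k) x^k <= (1 + x)^n <=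
    exp(n x) <= e^k. *)
Lemma binomial_le (n k m : nat) : (0 < m)%N -> (n <= 2 * m * k)%N ->
  'C(n, k)%:R <= (2 * m%:R * expR 1) ^+ k :> R.
Proof.
move=> m0 nmk; have m1 : 0 < 2 * m%:R :> R by rewrite mulr_gt0 ?ltr0n.
have [nk|kn] := ltnP n k.
  by rewrite bin_small// exprn_ge0// mulr_ge0 ?expR_ge0 ?ltW.
set x : R := (2 * m%:R)^-1; have x0 : 0 < x by rewrite invr_gt0.
have H : 'C(n, k)%:R * x ^+ k <= (1 + x) ^+ n.
  rewrite exprDn (bigD1 (Ordinal (kn : (k < n.+1)%N)))//= expr1n mul1r mulr_natl lerDl.
  by apply: sumr_ge0 => i _; rewrite mulrn_wge0// mulr_ge0 ?exprn_ge0 ?ltW.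
have {}H : 'C(n, k)%:R * x ^+ k <= expR 1 ^+ k.
  apply: (le_trans H); apply: (@le_trans _ _ (expR x ^+ n)).
    by rewrite lerXn2r ?nnegrE ?expR_ge0 ?expR_ge1Dx// ltW// addr_gt0.
  rewrite -!expRM_natl ler_expR mulr1 /x ler_pdivrMr// mulrC.
  by rewrite -!natrM ler_nat.
by rewrite exprMn mulrC -ler_pdivrMr ?exprn_gt0// -exprVn.
Qed.

End symmetric_sums.

Local Open Scope classical_set_scope.

(** * Measurability of digits, and Lebesgue measure under affine maps *)

Section measurability.
Context {R : realType}.

Lemma measurable_inv : measurable_fun [set: R] (@GRing.inv R).
Proof.
have m0 : measurable [set (0 : R)] by exact: measurable_set1.
(* Inversion is continuous away from 0, so this one point is split off. *)
rewrite -(setUv [set (0 : R)]) setUC.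
apply/(measurable_funU _ (measurableC m0) m0); split; last exact: measurable_fun_set1.
apply: open_continuous_measurable_fun.
  by rewrite openC; exact/accessible_closed_set1/hausdorff_accessible/Rhausdorff.
by move=> x; rewrite inE/= => /eqP x0; exact: inv_continuous.
Qed.

Lemma measurable_digit1 :
  measurable_fun [set: R] (fun x : R => (Num.truncn x^-1)%:R : R).
Proof.
apply: (measurableT_comp (f := fun x : R => (Num.truncn x)%:R : R)).
  apply: nondecreasing_measurable => // x y xy.
  by rewrite ler_nat le_truncn.
exact: measurable_inv.
Qed.

Lemma measurable_gauss : measurable_fun [set: R] (@gauss R).
Proof.
apply: measurable_funB; [exact: measurable_inv|exact: measurable_digit1].
Qed.

Lemma measurable_iter_gauss i : measurable_fun [set: R] (iter i (@gauss R)).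
Proof.
elim: i => [|i IH] /=; first exact: measurable_id.
by apply: measurableT_comp => //; exact: measurable_gauss.
Qed.

Lemma measurable_cf_digit i :
  measurable_fun [set: R] (fun x : R => (cf_digit i x)%:R : R).
Proof.
apply: (measurableT_comp (f := fun x : R => (Num.truncn x^-1)%:R : R)).
  exact: measurable_digit1.
exact: measurable_iter_gauss.
Qed.

Lemma measurable_S n k : measurable_fun [set: R] (fun x : R => S x n k).
Proof.
apply: measurable_funM => //.
under eq_fun do rewrite -big_filter.
apply: measurable_sum => A.
under eq_fun do rewrite -big_filter.
by apply: measurable_prod => i _; exact: measurable_cf_digit.
Qed.

Lemma measurable_irrational : measurable (@irrational R : set R).
Proof.
apply: measurableC; rewrite (_ : @rational R = \bigcup_q [set ratr q]).
  apply: countable_bigcupT_measurable => [|q]; first exact: countableP.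
  exact: measurable_set1.
by apply/seteqP; split => [_ [q _ <-]|_ [q _ ->]]; exists q.
Qed.

(** By uniqueness of Lebesgue measure: c times the pushforward under u |-> a - c u gives half-open
    intervals their length. *)
Lemma lebesgue_measure_affine (a c : R) (B : set R) : 0 < c -> measurable B ->
  lebesgue_measure [set u : R | B (a - c * u)] = ((c^-1)%:E * lebesgue_measure B)%E.
Proof.
move=> c0 mB; have c_ge0 := ltW c0.
pose f (u : measurableTypeR R) : measurableTypeR R := a - c * u.
have mf : measurable_fun [set: measurableTypeR R] f.
  by apply: measurable_funB => //; exact: measurable_funM.
(* Unification cannot find the argument mf of this instance. *)
pose nu : {measure set (measurableTypeR R) -> \bar R} :=
  measure_function_pushforward__canonical__measure_function_Measure
    (@lebesgue_measure R) mf.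
have H : lebesgue_measure B = mscale (NngNum c_ge0) nu B.
  apply: (lebesgue_measure_unique (mu := mscale (NngNum c_ge0) nu)) => //=.
  move=> _ [[x y]] _ <-.
  rewrite /mscale /= /pushforward.
  have -> : f @^-1` `]x, y] = `[((a - y) / c), ((a - x) / c)[%classic.
    rewrite /f; apply/seteqP.
    split => u /=; rewrite !in_itv/= => /andP[h1 h2]; apply/andP.
      by rewrite ler_pdivrMr // ltr_pdivlMr //; split; lra.
    by move: h1 h2; rewrite ler_pdivrMr // ltr_pdivlMr // => h1 h2; split; lra.
  rewrite !lebesgue_measure_itv/= !lte_fin ltr_pM2r ?invr_gt0//.
  rewrite ltrD2l ltrN2.
  case: ifP => xy; last by rewrite mule0.
  by rewrite -!EFinB -EFinM; congr (_%:E); field; exact: lt0r_neq0.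
rewrite H /mscale /= /pushforward/= muleA -EFinM mulVf ?mul1e//.
exact: lt0r_neq0.
Qed.

End measurability.

(** * The law of a Gauss iterate given the earlier digits *)

Section conditional_law.
Context {R : realType}.
Implicit Types (t u x : R) (B : set R) (j : nat).

(* Inverse of the conditional distribution function x |-> (1 + t) x / (1 + t x)
   of G^i alpha.  The conditional probability of B is then the Lebesgue measure
   of [cond_set t B], and that of {a >= j} is [digit_tail t j]; after a digit j
   the parameter t becomes (j + t)^-1. *)
Definition cdf_inv t u : R := u / (1 + t - t * u).

Definition cond_set t B : set R := [set u | 0 <= u < 1 /\ B (cdf_inv t u)].

Definition digit_tail t j : R := (1 + t) / (j%:R + t).

Lemma measurable_cond_set t B : measurable B -> measurable (cond_set t B).
Proof.
move=> mB.
have -> : cond_set t B = `[0, 1[ `&` cdf_inv t @^-1` B.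
  by apply/seteqP; split => u /=; rewrite in_itv.
have mf : measurable_fun (`[0, 1[%classic : set R) (cdf_inv t).
  apply: measurable_funTS; apply: measurable_funM => //.
  apply: (measurableT_comp (f := @GRing.inv R)); first exact: measurable_inv.
  by apply: measurable_funB => //; exact: measurable_funM.
exact: mf.
Qed.

(* On the interval of u coding the digit j, the Gauss map becomes the
   decreasing affine map u |-> v, so no change of variables beyond affine ones
   is needed. *)
Lemma cond_set_gauss t B u (j := Num.truncn (cdf_inv t u)^-1)
    (v := (j%:R + t + 1) * (j%:R + t) / (1 + t) * (digit_tail t j - u)) :
  0 <= t <= 1 -> 0 < u < 1 -> B (gauss (cdf_inv t u)) ->
  (0 < j)%N /\ cond_set (j%:R + t)^-1 B v.
Proof.
move=> /andP[t0 t1] /andP[u0 u1].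
have t1' : 0 < 1 + t by lra.
have d0 : 0 < 1 + t - t * u by nra.
have xE : (cdf_inv t u)^-1 = (1 + t) / u - t.
  by rewrite /cdf_inv invf_div; field; exact: lt0r_neq0.
have x1 : 1 <= (cdf_inv t u)^-1.
  by rewrite /cdf_inv invf_div ler_pdivlMr// mul1r; nra.
have j0 : (0 < j)%N by rewrite /j truncn_gt0.
have j1 : 1 <= j%:R :> R by rewrite ler1n.
have /andP[jx xj] := truncn_itv (le_trans ler01 x1).
rewrite -/j in jx xj; rewrite /gauss -/j => HB; split => //.
have yE : (cdf_inv t u)^-1 - j%:R = (1 + t) / u - (j%:R + t).
  by rewrite xE; ring.
have jt0 : 0 < j%:R + t by lra.
set y := (cdf_inv t u)^-1 - j%:R in HB yE.
have y0 : 0 <= y by rewrite subr_ge0.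
have y1 : y < 1 by rewrite ltrBlDl natr1.
have uy : u * (y + j%:R + t) = 1 + t.
  by rewrite yE; field; exact: lt0r_neq0.
have vE : v = (j%:R + t + 1) * u * y / (1 + t).
  rewrite /v /digit_tail -uy; field; rewrite !lt0r_neq0//; last by nra.
have v1 : v < 1.
  rewrite vE ltr_pdivrMr// mul1r -uy.
  have : (j%:R + t + 1) * y < y + j%:R + t by nra.
  by nra.
have v0 : 0 <= v.
  by rewrite vE; apply: divr_ge0; [apply: mulr_ge0 => //; apply: mulr_ge0|]; lra.
split; first by rewrite v0.
suff -> : cdf_inv (j%:R + t)^-1 v = y by [].
have wE : 1 + (j%:R + t)^-1 - (j%:R + t)^-1 * v = (j%:R + t + 1) * u / (1 + t).
  rewrite vE -uy; field; rewrite !lt0r_neq0//; nra.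
rewrite /cdf_inv wE vE; field; rewrite !lt0r_neq0//; lra.
Qed.

Lemma digit_tailB t j : 0 <= t -> (0 < j)%N ->
  digit_tail t j - digit_tail t j.+1 =
  ((j%:R + t + 1) * (j%:R + t) / (1 + t))^-1.
Proof.
move=> t0 j0; have j1 : 1 <= j%:R :> R by rewrite ler1n.
by rewrite /digit_tail -natr1; field; rewrite !lt0r_neq0//; lra.
Qed.

(** Total probability over the first digit j, which has probability
    [digit_tail t j - digit_tail t j.+1]. The part of the event with digit j lies in an affine copy
    of the conditional set for (j + t)^-1. The family [B] depends on j, so that the digit is
    remembered after the Gauss map; by countable subadditivity it suffices to bound the partial sums
    from [J0] on. *)
Lemma cond_set_step t (B : nat -> set R) (w : nat -> R) (b : R) J0 :
  0 <= t <= 1 -> (forall j, measurable (B j)) ->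
  measurable [set x : R | B (Num.truncn x^-1) (gauss x)] ->
  (forall j t', (0 < j)%N -> 0 <= t' <= 1 ->
    (lebesgue_measure (cond_set t' (B j)) <= (w j)%:E)%E) ->
  (forall J, (J0 <= J)%N ->
    \sum_(1 <= j < J.+1) (digit_tail t j - digit_tail t j.+1) * w j <= b) ->
  (lebesgue_measure (cond_set t [set x | B (Num.truncn x^-1) (gauss x)])
    <= b%:E)%E.
Proof.
move=> t01 mB mE Bw wb; have /andP[t0 t1] := t01.
pose c j : R := (j%:R + t + 1) * (j%:R + t) / (1 + t).
(* The digit 0 arises only at u = 0, from the convention that the inverse of 0 is 0; the null set
   [[set 0]] accounts for it. *)
pose F j : set R := if j is 0%N then [set 0] else
  [set u | cond_set (j%:R + t)^-1 (B j) (c j * digit_tail t j - c j * u)].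
have c0 j : (0 < j)%N -> 0 < c j.
  move=> j0; have j1 : 1 <= j%:R :> R by rewrite ler1n.
  by apply: divr_gt0; [apply: mulr_gt0|]; lra.
have mF j : measurable (F j).
  case: j => [|j]; first exact: measurable_set1.
  have mf : measurable_fun [set: R]
      (fun u : R => c j.+1 * digit_tail t j.+1 - c j.+1 * u).
    by apply: measurable_funB => //; exact: measurable_funM.
  rewrite -[X in measurable X]setTI; apply: mf => //.
  exact: measurable_cond_set.
have muF j : (0 < j)%N ->
    (lebesgue_measure (F j) <= ((digit_tail t j - digit_tail t j.+1) * w j)%:E)%E.
  case: j => // j _; rewrite /F lebesgue_measure_affine ?c0//; last first.
    exact: measurable_cond_set.
  rewrite digit_tailB// EFinM lee_pmul2l//; last first.
    by rewrite lte_fin invr_gt0; exact: c0.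
  apply: Bw => //; have j1 : 1 <= j.+1%:R :> R by rewrite ler1n.
  apply/andP; split; first by rewrite invr_ge0; lra.
  by rewrite invf_le1; lra.
set E := cond_set t _.
have mcE : measurable E by exact: measurable_cond_set.
suff EF : E `<=` \bigcup_j F j.
  apply: (le_trans (measure_sigma_subadditive (@lebesgue_measure R) mF mcE EF)).
  apply: lime_le; first exact: is_cvg_nneseries.
  exists J0.+1 => // J /= JJ.
  case: J JJ => // J JJ.
  rewrite big_mkord big_ord_recl /= lebesgue_measure_set1 add0e.
  apply: (@le_trans _ _ (\sum_(1 <= j < J.+1)
      (digit_tail t j - digit_tail t j.+1) * w j)%:E); last by rewrite lee_fin wb.
  rewrite big_add1 /= big_mkord -sumEFin.
  by apply: lee_sum => i _; exact: (muF i.+1).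
move=> u [/andP[u0 u1] /= Bu].
  have [u00|u_gt0] := eqVneq u 0; first by exists 0%N.
  have u01 : 0 < u < 1 by rewrite lt_neqAle eq_sym u_gt0 u0.
  have [j0 Hv] := cond_set_gauss t (B (Num.truncn (cdf_inv t u)^-1)) u t01 u01 Bu.
  exists (Num.truncn (cdf_inv t u)^-1) => //.
  case: (Num.truncn (cdf_inv t u)^-1) j0 Hv => // j _.
  by rewrite /F /= mulrBr.
Qed.

Lemma digit_tail_ge t j : 0 <= t -> (0 < j)%N -> j%:R^-1 <= digit_tail t j.
Proof.
move=> t0 j0; have j1 : 1 <= j%:R :> R by rewrite ler1n.
rewrite /digit_tail ler_pdivlMr; last lra.
rewrite ler_pdivrMl; last lra.
by nra.
Qed.

Lemma sum_digit_tailB t J : 0 <= t ->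
  \sum_(1 <= j < J.+1) (digit_tail t j - digit_tail t j.+1) <= 1.
Proof.
move=> t0; rewrite (telescope_sumr_eq (fun j => - digit_tail t j)) //; last first.
  by move=> j _; rewrite opprK addrC.
rewrite opprK {2}/digit_tail divff; last by rewrite lt0r_neq0//; lra.
rewrite -lerBrDr subrr oppr_le0 /digit_tail.
by apply: divr_ge0; rewrite addr_ge0.
Qed.

(** Each step averages a bound uniform in t with weights of sum at most 1. This moves an estimate
    for the first block of digits to any later block. *)
Lemma cond_set_iter_gauss i B (M : R) : measurable B -> 0 <= M ->
  (forall t, 0 <= t <= 1 -> (lebesgue_measure (cond_set t B) <= M%:E)%E) ->
  forall t, 0 <= t <= 1 ->
  (lebesgue_measure (cond_set t (iter i (@gauss R) @^-1` B)) <= M%:E)%E.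
Proof.
move=> mB M0 BM; elim: i => [//|i IH] t t01.
have mBi k : measurable (iter k (@gauss R) @^-1` B).
  by rewrite -[X in measurable X]setTI; exact: measurable_iter_gauss.
have iterE : iter i.+1 (@gauss R) @^-1` B =
    [set x | (iter i (@gauss R) @^-1` B) (gauss x)].
  by apply/seteqP; split => x /=; rewrite -iterSr.
rewrite iterE.
apply: (cond_set_step t (fun=> iter i (@gauss R) @^-1` B) (fun=> M) M 0) => //.
- by rewrite -iterE.
- by move=> j t' _; exact: IH.
move=> J _; rewrite -mulr_suml ler_piMl// sum_digit_tailB//.
by case/andP: t01.
Qed.

Definition small_block m (s : R) : set R :=
  [set x | \sum_(i < m) (cf_digit i.+1 x)%:R <= s].

Lemma measurable_small_block m (s : R) : measurable (small_block m s).
Proof.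
rewrite -[X in measurable X]setTI; apply: measurable_fun_le => //.
by apply: measurable_sum => i; exact: measurable_cf_digit.
Qed.

Lemma small_blockS m (s : R) : small_block m.+1 s =
  [set x | small_block m (s - (Num.truncn x^-1)%:R) (gauss x)].
Proof.
apply/seteqP; split => x; rewrite /small_block /= big_ord_recl /cf_digit /=;
  rewrite lerBrDl; under [in X in _ -> X]eq_bigr do rewrite -?iterSr;
  by under eq_bigr do rewrite -?iterSr.
Qed.

Definition harmonic_sum m : R := \sum_(1 <= j < m.+1) j%:R^-1.

Lemma harmonic_sumS m : harmonic_sum m.+1 = harmonic_sum m + m.+1%:R^-1.
Proof. by rewrite /harmonic_sum big_nat_recr. Qed.

(* Summation by parts: the weights decrease by 1 / (2 T) at each j <= T and the
   tails are at least 1 / j. *)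
Lemma sum_digit_tail_weight t T J : 0 <= t -> (0 < T)%N ->
  \sum_(1 <= j < J.+1) (digit_tail t j - digit_tail t j.+1) *
      (1 - (minn j T)%:R / (2 * T%:R))
    + digit_tail t J.+1 * (1 - (minn J T)%:R / (2 * T%:R))
  <= 1 - harmonic_sum (minn J T) / (2 * T%:R).
Proof.
move=> t0 T0.
have T1 : 0 < T%:R :> R by rewrite ltr0n.
have T2 : 0 < (2 * T%:R)^-1 :> R by rewrite invr_gt0 mulr_gt0.
elim: J => [|J IH].
  rewrite big_geq// min0n /harmonic_sum big_geq// !mul0r subr0 mulr1 add0r.
  by rewrite /digit_tail divff// lt0r_neq0//; lra.
rewrite big_nat_recr//=.
have dJ := digit_tail_ge t J.+1 t0 isT.
have [JT|JT] := leqP T J.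
  move: IH; rewrite (minn_idPr JT) (minn_idPr (leqW JT)); lra.
rewrite (minn_idPl JT); move: IH; rewrite (minn_idPl (ltnW JT)).
rewrite harmonic_sumS -natr1.
move: dJ T2; set a := (2 * _)^-1; set h := (J.+1%:R)^-1.
set A := \sum_(_ <= _ < _) _.
by nra.
Qed.
End conditional_law.

(** * Probability that a block of digits has a small sum *)

Section small_block_measure.
Context {R : realType}.

Lemma expRN_le (x : R) : 0 <= x <= 1 -> expR (- x) <= 1 - x / 2.
Proof.
move=> /andP[x0 x1]; have x1' : 0 < 1 + x by lra.
rewrite expRN; apply: (@le_trans _ _ (1 + x)^-1).
  by rewrite lef_pV2 ?posrE ?expR_gt0// expR_ge1Dx.
by rewrite -div1r ler_pdivrMr//; nra.
Qed.

Lemma harmonic_sum_le m : harmonic_sum m <= m%:R :> R.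
Proof.
elim: m => [|m IH]; first by rewrite /harmonic_sum big_geq.
rewrite harmonic_sumS -natr1; apply: lerD => //.
by rewrite natr1 invf_le1 ?ltr0n ?ler1n.
Qed.

Lemma ln_le_harmonic_sum m : ln (m.+1%:R : R) <= harmonic_sum m.
Proof.
elim: m => [|m IH]; first by rewrite /harmonic_sum big_geq// ln1.
have -> : m.+2%:R = m.+1%:R * (1 + m.+1%:R^-1) :> R.
  by rewrite mulrDr mulr1 mulfV ?pnatr_eq0// natr1.
have m0 : 0 < m.+1%:R^-1 :> R by rewrite invr_gt0 ltr0n.
rewrite lnM ?posrE ?addr_gt0 ?ltr0n// harmonic_sumS; apply: lerD => //.
by apply: le_ln1Dx; apply: lt_trans m0; rewrite ltrN10.
Qed.

(** The exponential Markov inequality, run as an induction on m without integrals: a first digit j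
    replaces s by s - j, and averaging exp(- j / T) over j costs a factor at most [rho]. The
    threshold s is any real, since s - j may become negative. *)
Lemma small_block_le m T (s t : R) : (0 < T)%N -> 0 <= t <= 1 ->
  (lebesgue_measure (cond_set t (small_block m s)) <=
   (expR (s / T%:R) * (1 - harmonic_sum T / (2 * T%:R)) ^+ m)%:E)%E.
Proof.
move=> T0; have T1 : 0 < T%:R :> R by rewrite ltr0n.
set rho := 1 - _.
have rho0 : 0 <= rho.
  rewrite subr_ge0 ler_pdivrMr ?mulr_gt0// mul1r.
  by apply: (le_trans (harmonic_sum_le T)); lra.
elim: m s t => [|m IH] s t t01.
  (* An empty sum is 0: the event is empty if s < 0, and otherwise 1 <= exp(s / T) is enough. *)
  rewrite expr0 mulr1; have [s0|s0] := leP 0 s; last first.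
    rewrite [X in lebesgue_measure X](_ : _ = set0) ?measure0 ?lee_fin ?expR_ge0//.
    by apply/seteqP; split => u //= [_]; rewrite /small_block /= big_ord0 leNgt s0.
  apply: (@le_trans _ _ (lebesgue_measure (`[0, 1[%classic : set R))).
    apply: le_measure; rewrite ?inE//.
      by apply: measurable_cond_set; exact: measurable_small_block.
    by move=> u [u01 _]; rewrite /= in_itv.
  rewrite lebesgue_measure_itv/= lte_fin ltr01 oppr0 adde0 lee_fin.
  by rewrite -expR0 ler_expR divr_ge0.
have mB j : measurable (small_block m (s - j%:R)) by exact: measurable_small_block.
have /andP[t0 t1] := t01.
rewrite small_blockS.
(* Starting the partial sums at [J0] = T makes [minn J T] equal to T, so the full [harmonic_sum T]
   appears. *)
apply: (cond_set_step t (fun j => small_block m (s - j%:R))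
  (fun j => expR ((s - j%:R) / T%:R) * rho ^+ m) _ T) => //.
- by rewrite -small_blockS; exact: measurable_small_block.
- by move=> j t' _; exact: IH.
move=> J TJ.
have dB j : (0 < j)%N -> 0 <= digit_tail t j - digit_tail t j.+1.
  by move=> j0; rewrite digit_tailB// invr_ge0 divr_ge0 ?mulr_ge0 ?addr_ge0.
have := sum_digit_tail_weight t T J t0 T0; rewrite (minn_idPr TJ) -/rho.
set g := fun j => 1 - (minn j T)%:R / (2 * T%:R) : R.
move=> sum_le.
have {}sum_le : \sum_(1 <= j < J.+1) (digit_tail t j - digit_tail t j.+1) * g j <= rho.
  apply: le_trans sum_le; rewrite lerDl; apply: mulr_ge0.
    by apply: divr_ge0; exact: addr_ge0.
  by rewrite subr_ge0 ler_pdivrMr ?mulr_gt0// mul1r ler_peMl// ler1n.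
apply: (@le_trans _ _ ((\sum_(1 <= j < J.+1) (digit_tail t j - digit_tail t j.+1) * g j)
  * (expR (s / T%:R) * rho ^+ m))); last first.
  by rewrite [X in _ <= X](_ : _ = rho * (expR (s / T%:R) * rho ^+ m));
    [rewrite ler_wpM2r// mulr_ge0 ?expR_ge0 ?exprn_ge0|rewrite exprS mulrCA].
rewrite mulr_suml; apply: ler_sum_nat => j /andP[j0 _].
rewrite -mulrA ler_wpM2l ?dB// mulrA ler_wpM2r ?exprn_ge0//.
rewrite mulrBl expRD mulrC ler_wpM2r ?expR_ge0//.
(* Truncating j at T brings the exponent into [0, 1], where exp(- x) <= 1 - x / 2. *)
apply: (@le_trans _ _ (expR (- ((minn j T)%:R / T%:R)))).
  by rewrite ler_expR lerN2 ler_pM2r ?invr_gt0// ler_nat geq_minl.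
apply: le_trans (expRN_le _ _) _.
  by rewrite divr_ge0//= ler_pdivrMr// mul1r ler_nat geq_minr.
by rewrite /g lerD2l lerN2 invfM mulrA [X in _ <= X]mulrAC.
Qed.

End small_block_measure.

(** * Numerical estimates for the block length and the failure probability *)

Section estimates.
Context {R : realType}.

(** Cancel n^(3/4) in n <= (n %/ k + 1) k <= (n %/ k + 1) n^(3/4). *)
Lemma divn_powR_ge (n k : nat) : (0 < n)%N -> (0 < k)%N ->
  k%:R <= (n%:R : R) `^ (3 / 4) ->
  expR (ln (n%:R : R) / 4) <= (n %/ k).+1%:R.
Proof.
move=> n0 k0; rewrite /powR pnatr_eq0 gtn_eqF// => kn.
have nE : (n%:R : R) = expR (3 / 4 * ln n%:R) * expR (ln n%:R / 4).
  by rewrite -expRD -mulrA -{1}(@lnK R n%:R) ?posrE ?ltr0n//; congr expR; field.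
have : (n%:R : R) <= (n %/ k).+1%:R * expR (3 / 4 * ln n%:R).
  apply: (@le_trans _ _ ((n %/ k).+1%:R * k%:R)); last by rewrite ler_wpM2l.
  by rewrite -natrM ler_nat mulnC -mulnC ltnW// ltn_ceil.
by rewrite {1}nE mulrC ler_pM2r ?expR_gt0.
Qed.

(** Take T to be the integer square root of m = n %/ k. With L = ln n, (T + 1)^2 >= m + 1 >= exp(L /
    4), so T + 1 >= exp(L / 24)^3 >= (1 + L / 24)^3. A cubic bound is enough to beat an exponent
    quadratic in L. *)
Lemma block_size_estimates (n k : nat) : (0 < n)%N -> (0 < k)%N ->
  k%:R <= (n%:R : R) `^ (3 / 4) -> 480 <= ln (n%:R : R) ->
  1 <= ln ((n %/ k)%:R : R) /\
  exists T : nat, [/\ (0 < T)%N, (T ^ 2 <= n %/ k < T.+1 ^ 2)%N &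
    (ln (n%:R : R) / 24) ^+ 3 <= T%:R].
Proof.
move=> n0 k0 kn L0; have := divn_powR_ge n k n0 k0 kn.
set m := (n %/ k)%N; set L := ln n%:R in L0 *; move=> Lm.
have Lm' : expR (L / 4) <= m%:R + 1 :> R by rewrite natr1.
have e1 : 2 <= expR 1 :> R by rewrite (le_trans _ (expR_ge1Dx 1))//; lra.
have m_ge : expR 1 <= m%:R :> R.
  have : expR 2 <= expR (L / 4) by rewrite ler_expR; lra.
  have -> : 2 = 1 + 1 :> R by [].
  rewrite expRD => /le_trans /(_ Lm'); nra.
have m0 : 0 < m%:R :> R by apply: lt_le_trans m_ge; exact: expR_gt0.
split; first by rewrite -[leLHS](@expRK R) ler_ln ?posrE ?expR_gt0.
have s0 : 0 <= Num.sqrt m%:R :> R by exact: sqrtr_ge0.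
have mE : m%:R = Num.sqrt m%:R ^+ 2 :> R by rewrite sqr_sqrtr// ltW.
exists (Num.truncn (Num.sqrt m%:R : R)); set T := Num.truncn _.
have /andP[Ts sT] := truncn_itv s0; rewrite -/T in Ts sT.
have Tm : (T ^ 2 <= m)%N.
  by rewrite -(ler_nat R) natrX mE lerXn2r ?nnegrE.
have mT : (m < T.+1 ^ 2)%N.
  by rewrite -(ltr_nat R) natrX mE ltrXn2r ?nnegrE.
have eT : expR (L / 8) <= T%:R + 1.
  rewrite -(@ler_pXn2r _ 2) ?nnegrE ?expR_ge0// ?addr_ge0// -expRM_natl.
  have -> : 2%:R * (L / 8) = L / 4 by field.
  by apply: (le_trans Lm); rewrite natr1 -natrX ler_nat.
have TL : (L / 24) ^+ 3 <= T%:R.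
  have e24 := expR_ge1Dx (L / 24).
  have eE : expR (L / 8) = expR (L / 24) ^+ 3.
    by rewrite -expRM_natl; congr expR; field.
  have : (1 + L / 24) ^+ 3 <= expR (L / 8).
    by rewrite eE lerXn2r ?nnegrE ?expR_ge0//; lra.
  rewrite (_ : (1 + L / 24) ^+ 3 =
    1 + 3 * (L / 24) + 3 * (L / 24) ^+ 2 + (L / 24) ^+ 3); last by ring.
  have := sqr_ge0 (L / 24); lra.
split => //; last by rewrite Tm.
by rewrite -(ltr_nat R) (lt_le_trans _ TL)// exprn_gt0//; lra.
Qed.

(** Since m < (T + 1)^2, ln m <= 2 H_T, and the exponent is at most L + (m / T) (ln m) (1/8 - 1/4)
    <= L - T / 8. With M = L / 24 >= 20 this is at most 24 M - M^3 / 8 <= - M^2, whence 480 = 24 *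
    20 and 576 = 24^2. *)
Lemma tail_estimate (m k T : nat) (L : R) : (0 < T)%N ->
  (T ^ 2 <= m < T.+1 ^ 2)%N -> 1 <= ln (m%:R : R) -> 480 <= L ->
  (L / 24) ^+ 3 <= T%:R -> k%:R <= expR L ->
  k%:R * (expR (m%:R * ln m%:R / 8 / T%:R) *
    (1 - harmonic_sum T / (2 * T%:R)) ^+ m) <= expR (- (576^-1 * L ^+ 2)).
Proof.
move=> T0 /andP[Tm mT] lm L0 LT kL.
have T1 : 1 <= T%:R :> R by rewrite ler1n.
have m0 : (0 < m)%N by rewrite (leq_trans _ Tm)// expn_gt0 T0.
have H2 : ln (m%:R : R) <= 2 * harmonic_sum T.
  apply: (@le_trans _ _ (2 * ln T.+1%:R)).
    rewrite mulr_natl -lnXn ?ltr0n// -natrX ler_ln ?posrE ?ltr0n ?expn_gt0//.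
    by rewrite ler_nat ltnW.
  by rewrite ler_pM2l// ln_le_harmonic_sum.
have rho_le : 1 - harmonic_sum T / (2 * T%:R) <= expR (- (ln m%:R / (4 * T%:R))) :> R.
  apply: le_trans (expR_ge1Dx _); rewrite lerD2l lerN2.
  have -> : ln m%:R / (4 * T%:R) = (ln m%:R / 2) / (2 * T%:R) :> R.
    by field; rewrite pnatr_eq0 -lt0n.
  by rewrite ler_pM2r ?invr_gt0 ?mulr_gt0 ?ltr0n//; lra.
have rho0 : 0 <= 1 - harmonic_sum T / (2 * T%:R) :> R.
  rewrite subr_ge0 ler_pdivrMr ?mulr_gt0 ?ltr0n// mul1r.
  by apply: (le_trans (harmonic_sum_le T)); lra.
apply: (@le_trans _ _ (expR L * (expR (m%:R * ln m%:R / 8 / T%:R) *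
  expR (- (ln m%:R / (4 * T%:R))) ^+ m))).
  apply: ler_pM => //; first by rewrite mulr_ge0 ?expR_ge0 ?exprn_ge0.
  by rewrite ler_wpM2l ?expR_ge0// lerXn2r ?nnegrE ?expR_ge0.
rewrite -expRM_natl -!expRD ler_expR.
have -> : L + (m%:R * ln m%:R / 8 / T%:R + m%:R * - (ln m%:R / (4 * T%:R)))
   = L - m%:R / T%:R * ln m%:R / 8.
  by field; rewrite pnatr_eq0 -lt0n.
have mT_ge : T%:R <= m%:R / T%:R :> R.
  by rewrite ler_pdivlMr ?ltr0n// -natrM ler_nat mulnn.
have : T%:R <= m%:R / T%:R * ln m%:R :> R.
  by apply: (le_trans mT_ge); rewrite ler_peMr// (le_trans _ mT_ge).
have M0 : 20 <= L / 24 by lra.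
have -> : 576^-1 * L ^+ 2 = (L / 24) ^+ 2 by field.
move: LT; set M := L / 24 in M0 *; have -> : L = 24 * M by rewrite /M; field.
rewrite exprS => LT ?.
have M2 : 20 * M <= M ^+ 2 by rewrite expr2 ler_wpM2r//; lra.
have M3 : 20 * M ^+ 2 <= M * M ^+ 2 by rewrite ler_wpM2r ?sqr_ge0.
lra.
Qed.

End estimates.

(** * From large block sums to the theorem *)

Lemma S_ge_of_blocks (R : realType) (n k m : nat) (s x : R) :
  (0 < m)%N -> (k * m <= n)%N -> (n <= 2 * m * k)%N -> 0 <= s ->
  (forall b : 'I_k, ~ small_block m s (iter (b * m) gauss x)) ->
  (s / (2 * m%:R * expR 1)) ^+ k <= S x n k.
Proof.
move=> m0 kmn nmk s0 Hb.
have kn : (k <= n)%N by apply: leq_trans kmn; rewrite leq_pmulr.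
have D0 : 0 < 2 * m%:R * expR 1 :> R by rewrite !mulr_gt0 ?expR_gt0 ?ltr0n.
rewrite /S ler_pdivlMl ?ltr0n ?bin_gt0//.
apply: (@le_trans _ _ (s ^+ k)).
  rewrite expr_div_n mulrCA ler_piMr ?exprn_ge0// ler_pdivrMr ?exprn_gt0// mul1r.
  exact: binomial_le.
apply: le_trans
  (@prod_block_sum_le R n k m (fun i => (cf_digit i.+1 x)%:R) _ kmn) => //.
rewrite -[X in s ^+ X]card_ord -prodr_const; apply: ler_prod => b _; rewrite s0/=.
(* The first m digits of the iterate of order b m are the digits of x numbered b m + 1 to b m +
   m. *)
have /negP := Hb b; rewrite /small_block /= -ltNge => /ltW /le_trans; apply.
by apply: ler_sum => r _; rewrite /cf_digit /= -iterD addnC.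
Qed.

Theorem theorem6p5 (R : realType) :
  exists (delta C : R) (N : nat), 0 < delta /\ 0 < C /\ (0 < N)%N /\
  forall n k : nat, (N <= n)%N -> (1 <= k)%N ->
    (k%:R <= (n%:R : R) `^ (3 / 4)) ->
    let A := [set alpha : R | 0 <= alpha <= 1 /\ irrational alpha /\
                (C * ln ((n %/ k)%N%:R)) ^+ k <= S alpha n k] in
    measurable A /\
    ((1 - expR (- (delta * (ln (n%:R : R)) ^+ 2)))%:E <= (@lebesgue_measure R) A)%E.
Proof.
(* C ln m is the block threshold (m ln m) / 8 divided by 2 e m; [N] forces ln n >= 480, and delta
   comes from [tail_estimate]. *)
exists 576^-1, (expR (- 1) / 16), (Num.truncn (expR 480 : R)).+1.
split; first by rewrite invr_gt0.
split; first by rewrite divr_gt0// expR_gt0.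
split=> // n k Nn k0 kn A.
have mA : measurable A.
  have -> : A = (`[0, 1]%classic `&` @irrational R) `&`
      [set x | (expR (- 1) / 16 * ln ((n %/ k)%N%:R)) ^+ k <= S x n k].
    by apply/seteqP; split => x; rewrite /A /= in_itv/=; tauto.
  apply: measurable_fun_le => //; last exact: measurable_funTS (measurable_S n k).
  by apply: measurableI => //; exact: measurable_irrational.
split => //.
have n_gt : expR 480 < n%:R :> R.
  apply: lt_le_trans (truncnS_gt _) _.
  by rewrite ler_nat.
have n0 : (0 < n)%N by rewrite -(ltr0n R) (lt_trans (expR_gt0 480)).
set L := ln n%:R.
have nE : n%:R = expR L :> R by rewrite lnK// posrE ltr0n.
have L0 : 480 <= L by rewrite ltW// -ltr_expR -nE.
have [] := block_size_estimates n k n0 k0 kn L0.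
rewrite -/L; set m := (n %/ k)%N in A mA * => lm [T [T0 Tm TL]].
have m0 : (0 < m)%N by case/andP: Tm => /(leq_trans _)-> //; rewrite expn_gt0 T0.
have kmn : (k * m <= n)%N by rewrite mulnC leq_trunc_div.
have nmk : (n <= 2 * m * k)%N.
  apply: ltnW; apply: (leq_trans (ltn_ceil n k0)).
  by rewrite leq_mul2r -/m; apply/orP; right; rewrite mul2n -addnn -addn1 leq_add2l.
have kL : k%:R <= expR L :> R.
  by rewrite -nE ler_nat; apply: leq_trans kmn; rewrite leq_pmulr.
have := @tail_estimate R m k T L T0 Tm lm L0 TL kL.
set s := m%:R * ln m%:R / 8; set p := _ * _ ^+ m => kp.
have s0 : 0 <= s by rewrite /s divr_ge0// mulr_ge0// (le_trans ler01).
(* [p] is nonnegative because it bounds a measure. *)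
have p0 : 0 <= p.
  move: (@small_block_le R m T s 0 T0); rewrite lexx ler01 => /(_ isT).
  by move/(le_trans (measure_ge0 _ _)); rewrite lee_fin.
(* At t = 0 [cdf_inv] is the identity, so [bad b] is the event inside [0, 1) that block b has a
   small sum. *)
pose bad b : set R := cond_set 0 (iter (b * m) (@gauss R) @^-1` small_block m s).
have mbad b : measurable (bad b).
  apply: measurable_cond_set; rewrite -[X in measurable X]setTI.
  by apply: measurable_iter_gauss => //; exact: measurable_small_block.
have bad_le b : (lebesgue_measure (bad b) <= p%:E)%E.
  apply: cond_set_iter_gauss => //; first exact: measurable_small_block.
  - by move=> t; exact: small_block_le.
  - by rewrite lexx ler01.
pose U := \big[setU/set0]_(b < k) bad b.
have mU : measurable U by exact: bigsetU_measurable.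
have U_le : (lebesgue_measure U <= (k%:R * p)%:E)%E.
  apply: (le_trans (Boole_inequality (@lebesgue_measure R) (A := bad) (n := k) _)).
    by move=> b _; exact: mbad.
  have -> : (k%:R * p)%:E = (\sum_(b < k) p%:E)%E.
    by rewrite sumEFin sumr_const card_ord mulr_natl.
  by apply: lee_sum => b _; exact: bad_le.
have mQ : measurable (@rational R : set R).
  by rewrite -(setCK (@rational R)); apply: measurableC; exact: measurable_irrational.
(* The blocks need not be independent: a union bound over [bad] and the nullity of the rationals
   suffice. *)
have cover : (`[0, 1[%classic : set R) `<=` A `|` (@rational R `|` U).
  move=> x; rewrite /= in_itv/= => /andP[x0 x1].
  have [Qx|Qx] := pselect (rational x); first by right; left.
  have [Ux|Ux] := pselect (U x); first by right; right.
  left; split; first by rewrite x0 ltW.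
  split => //.
  have -> : expR (- 1) / 16 * ln m%:R = s / (2 * m%:R * expR 1) :> R.
    rewrite expRN /s; field.
    by rewrite lt0r_neq0 ?expR_gt0//= pnatr_eq0 -lt0n.
  apply: S_ge_of_blocks => // b Hb; apply: Ux.
  rewrite /U -bigcup_mkord; exists b => //=.
  split; first by rewrite x0.
  by rewrite /cdf_inv addr0 mul0r subr0 divr1.
have Q0 : (lebesgue_measure (@rational R : set R) <= 0)%E.
  by rewrite lebesgue_measure_rat.
have H : (1 <= lebesgue_measure A + (expR (- (576^-1 * L ^+ 2)))%:E)%E.
  have -> : 1%E = lebesgue_measure (`[0, 1[%classic : set R).
    by rewrite lebesgue_measure_itv/= lte_fin ltr01 oppr0 adde0.
  have mQU : measurable (@rational R `|` U) by exact: measurableU.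
  apply: (@le_trans _ _ (lebesgue_measure (A `|` (@rational R `|` U)))).
    by apply: le_measure => //; rewrite ?inE//; exact: measurableU.
  apply: (le_trans (measureU2 (@lebesgue_measure R) mA mQU)); apply: leeD => //.
  apply: (le_trans (measureU2 (@lebesgue_measure R) mQ mU)); rewrite -[leRHS]add0e.
  apply: leeD; first exact: Q0.
  by apply: (le_trans U_le); rewrite lee_fin.
by rewrite EFinB leeBlDr.
Qed.
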